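(* Let $M$ be a regular smooth curve in $\mathbb{R}^p$ with arclength parametrization $\gamma:[0,a]\to\mathbb{R}^p$, and let $P(t)$ be the probability density function. Then, for $f\in C^2(M)$ (viewed as a function of $t$) and $\epsilon$ sufficiently small, $$\mathcal{D}_\epsilon f(t)=\begin{cases}-\frac{1}{12}\big(1-4(\frac{t}{\epsilon})+(\frac{t}{\epsilon})^2\big)f''(t)+\frac{6\epsilon^2(\epsilon-t)}{P(t)(\epsilon+t)^3}f'(t) & \text{if } t\in[0,\epsilon],\\[2pt] \frac16 f''(t) & \text{if } t\in[\epsilon,a-\epsilon],\\[2pt] -\frac{1}{12}\big(1-4(\frac{a-t}{\epsilon})+(\frac{a-t}{\epsilon})^2\big)f''(t)-\frac{6\epsilon^2(\epsilon+t-a)}{P(t)(\epsilon+a-t)^3}f'(t) & \text{if } t\in[a-\epsilon,a].\end{cases}$$ Specifically, $\mathcal{D}_\epsilon f(t)$ degenerates to $\frac{2\sqrt3}{P(t)}f'(t)$ at $t=(2-\sqrt3)\epsilon$ and $t=a-(2-\sqrt3)\epsilon$.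
   Context: The operator $\mathcal{D}_\epsilon$ is defined for a $d$-dimensional compact smooth Riemannian manifold $M$ with smooth boundary isometrically embedded in $\mathbb{R}^p$ and a probability density function $P$ on $M$ (with $P\in C^2(M)$, bounded above and bounded below by a positive constant); here $d=1$. Let $\tilde\epsilon_x$ be the geodesic distance from $x$ to $\partial M$. Use normal coordinates at $x$ with orthonormal frame $\partial_1,\ldots,\partial_d$, where, for $x$ with $\tilde\epsilon_x<\epsilon$, $\partial_d$ points toward the nearest boundary point (outward). Thus, for the curve, $\partial_d f(t)=-f'(t)$ for $t\in[0,\epsilon]$ and $\partial_d f(t)=f'(t)$ for $t\in[a-\epsilon,a]$. For $f\in C^2(M)$, $$\mathcal{D}_\epsilon f(x)=\phi_1(\tilde\epsilon_x)\sum_{i=1}^{d-1}\partial^2_{ii}f(x)+\phi_2(\tilde\epsilon_x)\partial^2_{dd}f(x)+V(x)\partial_d f(x)$$ (the sum is empty for $d=1$), with $$\phi_1=\frac12\frac{\sigma_{2,d}\sigma_2-\sigma_3\sigma_{1,d}}{\sigma_{2,d}\sigma_0-\sigma_{1,d}^2},\quad\phi_2=\frac12\frac{\sigma_{2,d}^2-\sigma_{3,d}\sigma_{1,d}}{\sigma_{2,d}\sigma_0-\sigma_{1,d}^2},\quad V(x)=\frac{\sigma_{1,d}(\tilde\epsilon_x)}{P(x)\big(\sigma_{2,d}(\tilde\epsilon_x)\sigma_0(\tilde\epsilon_x)-\sigma_{1,d}^2(\tilde\epsilon_x)\big)}.$$ Here $|S^m|$ is the volume of the unit $m$-sphere ($|S^0|=2$),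 $\frac{|S^{d-2}|}{d-1}:=1$ when $d=1$ (so $\frac{|S^{d-2}|}{d^2-1}=\frac{1}{d+1}\cdot\frac{|S^{d-2}|}{d-1}=\frac12$ then), and for $0\le t\le\epsilon$: $\sigma_0(t)=\frac{|S^{d-1}|}{2d}+\frac{|S^{d-2}|}{d-1}\int_0^{t/\epsilon}(1-x^2)^{\frac{d-1}{2}}dx$; $\sigma_{1,d}(t)=-\frac{|S^{d-2}|}{d^2-1}(1-(t/\epsilon)^2)^{\frac{d+1}{2}}$; $\sigma_2(t)=\frac{|S^{d-1}|}{2d(d+2)}+\frac{|S^{d-2}|}{d^2-1}\int_0^{t/\epsilon}(1-x^2)^{\frac{d+1}{2}}dx$; $\sigma_{2,d}(t)=\frac{|S^{d-1}|}{2d(d+2)}+\frac{|S^{d-2}|}{d-1}\int_0^{t/\epsilon}(1-x^2)^{\frac{d-1}{2}}x^2dx$; $\sigma_3(t)=-\frac{|S^{d-2}|}{(d^2-1)(d+3)}(1-(t/\epsilon)^2)^{\frac{d+3}{2}}$; $\sigma_{3,d}(t)=-\frac{|S^{d-2}|}{(d^2-1)(d+3)}(2+(d+1)(t/\epsilon)^2)(1-(t/\epsilon)^2)^{\frac{d+1}{2}}$. For $t>\epsilon$: $\sigma_0=\frac{|S^{d-1}|}{d}$, $\sigma_2=\sigma_{2,d}=\frac{|S^{d-1}|}{d(d+2)}$, $\sigma_{1,d}=\sigma_3=\sigma_{3,d}=0$.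
   Formalization: In the ''Specifically'' clause the coefficient 2√3/P(t) is wrong: the displayed formula gives (1+2/√3)/P(t) at t=(2−√3)ε and −(1+2/√3)/P(t) at t=a−(2−√3)ε, and these corrected values are what is proved. *)

(* Defs.v *)
From HB Require Import structures.
From mathcomp Require Import all_boot all_order all_algebra.
From mathcomp Require Import all_classical all_reals all_analysis.

Set Implicit Arguments.
Unset Strict Implicit.
Unset Printing Implicit Defensive.

Import Order.TTheory GRing.Theory Num.Theory.
Import numFieldNormedType.Exports.
Local Open Scope classical_set_scope.
Local Open Scope ring_scope.

(* Derivatives relative to a set A of parameters; on a closed interval they
   are one-sided at the endpoints. *)
Definition diff_quot (R : realType) (V : normedModType R)
    (g : R -> V) (t s : R) : V := (s - t)^-1 *: (g s - g t).

Definition derivable_in (R : realType) (V : normedModType R)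
    (A : set R) (g : R -> V) (t : R) : Prop :=
  cvg (diff_quot g t @ within A t^').

Definition deriv_in (R : realType) (V : normedModType R)
    (A : set R) (g : R -> V) (t : R) : V :=
  lim (diff_quot g t @ within A t^').

Definition deriv_in_n (R : realType) (V : normedModType R)
    (A : set R) (k : nat) (g : R -> V) : R -> V :=
  iter k (deriv_in A) g.

Definition C_in (R : realType) (V : normedModType R)
    (A : set R) (k : nat) (g : R -> V) : Prop :=
  (forall j t, (j < k)%N -> A t -> derivable_in A (deriv_in_n A j g) t) /\
  {within A, continuous (deriv_in_n A k g)}.

Definition smooth_in (R : realType) (V : normedModType R)
    (A : set R) (g : R -> V) : Prop := forall k, C_in A k g.

(* The library norm `|v| on row vectors is the sup norm. *)
Definition enorm (R : realType) (p : nat) (v : 'rV[R]_p) : R :=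
  Num.sqrt (\sum_(i < p) v ord0 i ^+ 2).

Definition path_length (R : realType) (p : nat) (c : R -> 'rV[R]_p) : R :=
  \int[lebesgue_measure]_(s in `[0, 1]) enorm (deriv_in `[0, 1] c s).

Definition geodesic_dist (R : realType) (p : nat) (M : set 'rV[R]_p)
    (x y : 'rV[R]_p) : R :=
  inf [set l | exists c : R -> 'rV[R]_p,
    [/\ C_in `[0, 1] 1 c, c @` `[0, 1] `<=` M, c 0 = x, c 1 = y
      & l = path_length c]].

(* M = curve gamma a is an embedded arc, with boundary its two ends. *)
Definition arclength_curve (R : realType) (p : nat)
    (gamma : R -> 'rV[R]_p) (a : R) : Prop :=
  [/\ 0 < a,
      smooth_in `[0, a] gamma,
      (forall t, t \in `[0, a] -> enorm (deriv_in `[0, a] gamma t) = 1)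
    & {in `[0, a] &, injective gamma}].

Definition curve (R : realType) (p : nat)
    (gamma : R -> 'rV[R]_p) (a : R) : set 'rV[R]_p := gamma @` `[0, a].

Definition curve_boundary (R : realType) (p : nat)
    (gamma : R -> 'rV[R]_p) (a : R) : set 'rV[R]_p := [set gamma 0; gamma a].

Definition C2_on_curve (R : realType) (p : nat) (gamma : R -> 'rV[R]_p) (a : R)
    (f : 'rV[R]_p -> R) : Prop :=
  C_in `[0, a] 2 (f \o gamma : R -> R).

(* The Riemannian volume of the curve is the arclength dt. *)
Definition density_on_curve (R : realType) (p : nat)
    (gamma : R -> 'rV[R]_p) (a : R) (P : 'rV[R]_p -> R) : Prop :=
  [/\ C2_on_curve gamma a P,
      (exists m N : R, 0 < m /\
        forall x, curve gamma a x -> m <= P x /\ P x <= N)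
    & \int[lebesgue_measure]_(t in `[0, a]) P (gamma t) = 1].

Definition boundary_dist (R : realType) (p : nat)
    (gamma : R -> 'rV[R]_p) (a : R) (x : 'rV[R]_p) : R :=
  inf [set geodesic_dist (curve gamma a) x y | y in curve_boundary gamma a].

(* The orthonormal frames at gamma t are the unit tangent vectors
   o *: gamma' t with o = 1 or o = -1, and the corresponding normal coordinate
   is s |-> gamma (t + o * s), defined for s in normal_dom a t o. *)
Definition normal_dom (R : realType) (a t o : R) : set R :=
  [set s | 0 <= t + o * s <= a].

(* Near the boundary the frame vector points to the nearest boundary point, and
   outward on the boundary: the geodesic that it starts leaves the curve exactly
   at time boundary_dist. *)
Definition boundary_frame (R : realType) (p : nat)
    (gamma : R -> 'rV[R]_p) (a eps : R) (o : R -> R) : Prop :=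
  forall t, t \in `[0, a] ->
    (o t = 1 \/ o t = -1) /\
    (boundary_dist gamma a (gamma t) < eps ->
     forall s, 0 <= s ->
       (normal_dom a t (o t) s <-> s <= boundary_dist gamma a (gamma t))).

(* k-th derivative at gamma t along the frame vector, in normal coordinates *)
Definition frame_deriv (R : realType) (p : nat)
    (gamma : R -> 'rV[R]_p) (a : R) (o : R -> R) (k : nat)
    (f : 'rV[R]_p -> R) (t : R) : R :=
  deriv_in_n (normal_dom a t (o t)) k
    (fun s : R => f (gamma (t + o t * s)) : R) 0.

(* Volume of the unit m-sphere, from |S^(m+2)| = 2 pi / (m+1) * |S^m|. *)
Fixpoint sphere_vol (R : realType) (m : nat) : R :=
  match m with
  | 0%N => 2
  | 1%N => 2 * pi
  | m'.+2 => 2 * pi / m'.+1%:R * sphere_vol R m'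
  end.

(* |S^(d-2)| / (d-1), with value 1 at d = 1 (d = 0 is not used); thus
   |S^(d-2)| / (d^2-1) = sphere_ratio d / (d+1). *)
Definition sphere_ratio (R : realType) (d : nat) : R :=
  if d is d'.+2 then sphere_vol R d' / d'.+1%:R else 1.

Definition sigma0 (R : realType) (d : nat) (eps t : R) : R :=
  if t <= eps then
    sphere_vol R d.-1 / (2 * d%:R) + sphere_ratio R d *
      \int[lebesgue_measure]_(x in `[0, t / eps])
        ((1 - x ^+ 2) `^ ((d%:R - 1) / 2))
  else sphere_vol R d.-1 / d%:R.

Definition sigma1d (R : realType) (d : nat) (eps t : R) : R :=
  if t <= eps then
    - (sphere_ratio R d / d.+1%:R *
       (1 - (t / eps) ^+ 2) `^ ((d%:R + 1) / 2))
  else 0.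

Definition sigma2 (R : realType) (d : nat) (eps t : R) : R :=
  if t <= eps then
    sphere_vol R d.-1 / (2 * d%:R * (d%:R + 2)) + sphere_ratio R d / d.+1%:R *
      \int[lebesgue_measure]_(x in `[0, t / eps])
        ((1 - x ^+ 2) `^ ((d%:R + 1) / 2))
  else sphere_vol R d.-1 / (d%:R * (d%:R + 2)).

Definition sigma2d (R : realType) (d : nat) (eps t : R) : R :=
  if t <= eps then
    sphere_vol R d.-1 / (2 * d%:R * (d%:R + 2)) + sphere_ratio R d *
      \int[lebesgue_measure]_(x in `[0, t / eps])
        ((1 - x ^+ 2) `^ ((d%:R - 1) / 2) * x ^+ 2)
  else sphere_vol R d.-1 / (d%:R * (d%:R + 2)).

Definition sigma3 (R : realType) (d : nat) (eps t : R) : R :=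
  if t <= eps then
    - (sphere_ratio R d / (d.+1%:R * (d%:R + 3)) *
       (1 - (t / eps) ^+ 2) `^ ((d%:R + 3) / 2))
  else 0.

Definition sigma3d (R : realType) (d : nat) (eps t : R) : R :=
  if t <= eps then
    - (sphere_ratio R d / (d.+1%:R * (d%:R + 3)) *
       (2 + (d%:R + 1) * (t / eps) ^+ 2) *
       (1 - (t / eps) ^+ 2) `^ ((d%:R + 1) / 2))
  else 0.

Definition phi_den (R : realType) (d : nat) (eps t : R) : R :=
  sigma2d d eps t * sigma0 d eps t - sigma1d d eps t ^+ 2.

Definition phi1 (R : realType) (d : nat) (eps t : R) : R :=
  2^-1 * ((sigma2d d eps t * sigma2 d eps t - sigma3 d eps t * sigma1d d eps t)
          / phi_den d eps t).

Definition phi2 (R : realType) (d : nat) (eps t : R) : R :=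
  2^-1 * ((sigma2d d eps t ^+ 2 - sigma3d d eps t * sigma1d d eps t)
          / phi_den d eps t).

Definition drift (R : realType) (d : nat) (eps Px t : R) : R :=
  sigma1d d eps t / (Px * phi_den d eps t).

(* D_eps f (x) in dimension d = n.+1, from the distance tx of x to the
   boundary, Px = P x, the second derivatives d2 i of f along the i-th frame
   vector, and the first derivative dd along the last one. *)
Definition D_op (R : realType) (n : nat) (eps tx Px : R)
    (d2 : 'I_n.+1 -> R) (dd : R) : R :=
  phi1 n.+1 eps tx * (\sum_(i < n) d2 (widen_ord (leqnSn n) i))
  + phi2 n.+1 eps tx * d2 ord_max + drift n.+1 eps Px tx * dd.

Definition D_curve (R : realType) (p : nat)
    (gamma : R -> 'rV[R]_p) (a : R) (P : 'rV[R]_p -> R) (eps : R)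
    (o : R -> R) (f : 'rV[R]_p -> R) (t : R) : R :=
  @D_op R 0 eps (boundary_dist gamma a (gamma t)) (P (gamma t))
    (fun=> frame_deriv gamma a o 2 f t) (frame_deriv gamma a o 1 f t).

(* Main.v *)
Require Import Defs.
From HB Require Import structures.
From mathcomp Require Import all_boot all_order all_algebra.
From mathcomp Require Import all_classical all_reals all_analysis.
From mathcomp Require Import ring lra.

Set Implicit Arguments.
Unset Strict Implicit.
Unset Printing Implicit Defensive.

Import Order.TTheory GRing.Theory Num.Theory.
Import numFieldNormedType.Exports.
Local Open Scope classical_set_scope.
Local Open Scope ring_scope.

(** The formula reduces to three independent facts about the curve.

    Distance to the boundary.  The intrinsic distance of gamma t and gamma b is
    |b - t|: the arc between them is a path of that length, and conversely any
    C^1 path c in the curve lifts to a parameter path tau with gamma o tau = c.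
    The lift is continuous because gamma is a homeomorphism onto its image (a
    continuous injection from a compact set), and taking the inner product of
    c(x) - c(s) = gamma(tau x) - gamma(tau s) with the unit vector
    gamma'(tau s) shows that it is differentiable, with
    tau' = <c', gamma'(tau)>.  The fundamental theorem of calculus and the
    Cauchy-Schwarz inequality give |b - t| <= length c
    ([arclength_le_path_length]).  Hence the distance to the boundary is
    min(t, a - t) ([boundary_dist_curve]).

    Frame.  Normal coordinates at gamma t are s |-> gamma (t + o s) with
    o = 1 or o = -1, so the chain rule for affine maps gives o f' and
    o^2 f'' = f'' ([frame_derivE]).  For eps < a / 2 the points closer than eps
    to the boundary fall into two end pieces; the geodesic must run out of the
    curve exactly at the boundary distance, which forces o = -1 on the piece
    at 0 and o = 1 on the piece at a ([boundary_frame_left],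
    [boundary_frame_right]).

    Coefficients.  With u = t / eps, dimension one gives sigma_0 = 1 + u,
    sigma_1 = - (1 - u^2) / 2, sigma_2 = (1 + u^3) / 3 and
    sigma_3 = - (1 - u^4) / 4 (the d-components), so the common denominator is
    (1 + u)^4 / 12 and everything simplifies ([phi2_dim1], [drift_dim1]).  At
    u = 1 the drift vanishes and phi_2 = 1/6, so the formulas of the pieces
    agree at their common points, where the frame is not determined.

    Finally 2 - sqrt 3 is the root of 1 - 4 u + u^2 in [0, 1], which kills the
    second-order term. *)

(** * Derivatives relative to a set of parameters *)

(** The relational form of the derivative composes without asking at each step
    whether the limit is unique. *)
Definition has_deriv_in (R : realType) (V : normedModType R)
    (A : set R) (g : R -> V) (t : R) (l : V) : Prop :=
  diff_quot g t @ within A t^' --> l.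

(** Limits at t within A are unique as soon as A contains a nondegenerate
    segment issued from t, whichever its direction; this covers interior
    points and both ends of an interval. *)
Lemma segment_within_dnbhs_proper (R : realType) (A : set R) (t e : R) :
  e != 0 -> (forall x, 0 <= x <= 1 -> A (t + x * e)) ->
  ProperFilter (within A t^').
Proof.
move=> e0 Ae; apply: Build_ProperFilter => -[/= d d0] /=.
have de0 : 0 < d / (2 * `|e|) by rewrite divr_gt0// mulr_gt0// normr_gt0.
set x := Num.min 1 (d / (2 * `|e|)).
have x0 : 0 < x by rewrite lt_min ltr01.
move=> /(_ (t + x * e)); apply.
- rewrite /ball_ /= opprD addNKr normrN normrM (gtr0_norm x0).
  apply: (@le_lt_trans _ _ (d / (2 * `|e|) * `|e|)).
    by rewrite ler_wpM2r// ge_min lexx orbT.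
  have -> : d / (2 * `|e|) * `|e| = d / 2.
    by field; rewrite normr_eq0.
  by rewrite ltr_pdivrMr// ltr_pMr// ltr1n.
- by rewrite -subr_eq0 addrC addKr mulf_neq0// gt_eqF.
- by apply: Ae; rewrite (ltW x0) ge_min lexx.
Qed.

Lemma deriv_inE (R : realType) (V : normedModType R) (A : set R) (g : R -> V)
    (t : R) (l : V) :
  ProperFilter (within A t^') -> has_deriv_in A g t l -> deriv_in A g t = l.
Proof. by move=> PF; exact: (@cvg_lim V (@norm_hausdorff _ _)). Qed.

Lemma eq_has_deriv_in (R : realType) (V : normedModType R) (A : set R)
    (g h : R -> V) (t : R) (l : V) :
  (forall x, A x -> g x = h x) -> A t ->
  has_deriv_in A g t l -> has_deriv_in A h t l.
Proof.
move=> gh At; apply: cvg_trans; apply: near_eq_cvg.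
rewrite near_withinE; near=> x => Ax.
by rewrite /diff_quot !gh.
Unshelve. all: by end_near. Qed.

(** The case k = 0 is meaningful: it makes the constant path between two equal
    endpoints an instance of the affine reparametrization. *)
Lemma has_deriv_in_affine (R : realType) (V : normedModType R) (A B : set R)
    (g : R -> V) (t k s : R) (l : V) :
  (forall x, B x -> A (t + k * x)) ->
  has_deriv_in A g (t + k * s) l ->
  has_deriv_in B (fun x => g (t + k * x)) s (k *: l).
Proof.
move=> BA gl; rewrite /has_deriv_in.
have [->|k0] := eqVneq k 0.
  rewrite scale0r; apply: cvg_near_cst; near=> x.
  by rewrite /diff_quot !mul0r subrr scaler0.
have -> : diff_quot (fun x => g (t + k * x)) s =
    fun x => k *: diff_quot g (t + k * s) (t + k * x).
  apply/funext => x; rewrite /diff_quot scalerA; congr (_ *: _).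
  have -> : t + k * x - (t + k * s) = k * (x - s) by ring.
  by rewrite invfM mulrA mulfV// mul1r.
apply: cvgZr; apply: cvg_comp gl => U /= [e e0 eU].
have ek0 : 0 < e / `|k| by rewrite divr_gt0// normr_gt0.
exists (e / `|k|) => // x /= sx xs Bx; apply: eU => //=.
- have -> : t + k * s - (t + k * x) = k * (s - x) by ring.
  by rewrite normrM mulrC -ltr_pdivlMr// normr_gt0.
- by rewrite (inj_eq (addrI t)) (inj_eq (mulfI k0)).
- exact: BA.
Unshelve. all: by end_near. Qed.

Lemma has_deriv_in_continuous (R : realType) (V : normedModType R) (A : set R)
    (g : R -> V) (t : R) (l : V) :
  has_deriv_in A g t l -> g @ within A (nbhs t) --> g t.
Proof.
move=> gl.
have : (fun x => g t + (x - t) *: diff_quot g t x) @ within A t^' -->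
       g t + (t - t) *: l.
  apply: cvgD; first exact: cvg_cst.
  apply: cvgZ => //; apply: cvgB; last exact: cvg_cst.
  by apply: cvg_trans (cvg_within _) _; exact: cvg_within.
rewrite subrr scale0r addr0 => h.
apply/cvgrPdist_lt => e e0.
move/cvgrPdist_lt : h => /(_ e e0); rewrite !near_withinE.
apply: filterS => x; rewrite /= => H Ax.
have [->|xt] := eqVneq x t; first by rewrite subrr normr0.
have := H xt Ax; rewrite /diff_quot scalerA mulfV ?subr_eq0// scale1r.
by rewrite [g t + _]addrC subrK.
Qed.

(** * Euclidean inner product *)

Definition dot (R : realType) (p : nat) (u v : 'rV[R]_p) : R :=
  \sum_(i < p) u ord0 i * v ord0 i.

Lemma cvg_dot (R : realType) (p : nat) (T : Type) (F : set_system T)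
    (FF : Filter F) (f g : T -> 'rV[R]_p) (u v : 'rV[R]_p) :
  f @ F --> u -> g @ F --> v -> (fun x => dot (f x) (g x)) @ F --> dot u v.
Proof.
move=> fu gv; rewrite /dot; apply: cvg_big; first exact: add_continuous.
move=> i _; apply: cvgM.
- by apply: (cvg_comp f (fun w : 'rV[R]_p => w ord0 i) fu); exact: coord_continuous.
- by apply: (cvg_comp g (fun w : 'rV[R]_p => w ord0 i) gv); exact: coord_continuous.
Qed.

Lemma dotZl (R : realType) (p : nat) (k : R) (u v : 'rV[R]_p) :
  dot (k *: u) v = k * dot u v.
Proof.
by rewrite /dot mulr_sumr; apply: eq_bigr => i _; rewrite mxE mulrA.
Qed.

Lemma enormE (R : realType) (p : nat) (u : 'rV[R]_p) :
  enorm u = Num.sqrt (dot u u).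
Proof. by congr Num.sqrt; apply: eq_bigr => i _; rewrite expr2. Qed.

Lemma dot_enorm1 (R : realType) (p : nat) (u : 'rV[R]_p) :
  enorm u = 1 -> dot u u = 1.
Proof.
rewrite enormE => u1; rewrite -[LHS]sqr_sqrtr ?u1 ?expr1n//.
by apply: sumr_ge0 => i _; rewrite -expr2 sqr_ge0.
Qed.

Lemma enormZ (R : realType) (p : nat) (k : R) (u : 'rV[R]_p) :
  enorm (k *: u) = `|k| * enorm u.
Proof.
rewrite !enormE.
have -> : dot (k *: u) (k *: u) = k ^+ 2 * dot u u.
  rewrite dotZl expr2 -mulrA; congr (_ * _).
  by rewrite /dot mulr_sumr; apply: eq_bigr => i _; rewrite mxE mulrCA.
by rewrite sqrtrM ?sqr_ge0// sqrtr_sqr.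
Qed.

(** Cauchy-Schwarz against a unit vector v: the squared norm of u minus its
    projection <u, v> v is |u|^2 - <u, v>^2. *)
Lemma normr_dot_le_enorm (R : realType) (p : nat) (u v : 'rV[R]_p) :
  enorm v = 1 -> `|dot u v| <= enorm u.
Proof.
move=> /dot_enorm1 v1; rewrite enormE -sqrtr_sqr; apply: ler_wsqrtr.
set k := dot u v; rewrite -subr_ge0.
have -> : dot u u - k ^+ 2 = \sum_(i < p) (u ord0 i - k * v ord0 i) ^+ 2.
  transitivity (dot u u - (2 * k) * dot u v + k ^+ 2 * dot v v).
    by rewrite v1 -/k; ring.
  rewrite /dot; move: k => k; rewrite !mulr_sumr -sumrB -big_split /=.
  by apply: eq_bigr => i _; ring.
by apply: sumr_ge0 => i _; rewrite sqr_ge0.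
Qed.

(** * Lifting a path through an injective parametrization *)

(** A continuous injection g of a compact set A is a closed map: if O is an open
    neighbourhood of y, the image of A \ O is closed and misses g y, so it is
    eventually avoided by c, that is, tau ends up in O. *)
Lemma cvg_injective_lift (S : Type) (T U : topologicalType) (A : set T)
    (g : T -> U) (tau : S -> T) (c : S -> U) (F : set_system S)
    (FF : Filter F) (y : T) :
  hausdorff_space U -> compact A -> {within A, continuous g} ->
  {in A &, injective g} -> A y ->
  (\forall s \near F, A (tau s) /\ g (tau s) = c s) ->
  c @ F --> g y -> tau @ F --> y.
Proof.
move=> hU cA cg ginj Ay lift cy W; rewrite nbhsE; case=> O [oO Oy] OW.
have clK : closed (g @` (A `&` ~` O)).
  apply: compact_closed => //; apply: continuous_compact.
    by apply: continuous_subspaceW cg => x [].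
  by apply: compact_closedI => //; rewrite closedC.
have : nbhs (g y) (~` (g @` (A `&` ~` O))).
  apply: open_nbhs_nbhs; split; first by rewrite openC.
  move=> -[x [Ax Ox]] gxy; apply: Ox.
  by rewrite (ginj x y) ?inE.
move/cy => /=; move: lift; rewrite /= !near_simpl; apply: filterS2.
move=> s [As gs] ncs; apply: OW; apply: contrapT => nO.
by apply: ncs; exists (tau s).
Qed.

(** Write the increment of c = g o tau in two ways and take the inner product
    with v: <c x - c s, v> = (tau x - tau s) q (tau x), where q tends to
    <v, v> = 1. *)
Lemma has_deriv_in_lift (R : realType) (p : nat) (A B : set R)
    (g c : R -> 'rV[R]_p) (tau : R -> R) (s : R) (v w : 'rV[R]_p) :
  (forall x, B x -> A (tau x) /\ g (tau x) = c x) -> B s ->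
  tau @ within B (nbhs s) --> tau s ->
  enorm v = 1 -> has_deriv_in A g (tau s) v -> has_deriv_in B c s w ->
  has_deriv_in B tau s (dot w v).
Proof.
move=> lift Bs ctau /dot_enorm1 v1 gv cw.
(* tau x = tau s may happen for x arbitrarily close to s, where the quotient
   of g has the value 0; q is extended by its limit. *)
pose q y := if y == tau s then 1 else dot (diff_quot g (tau s) y) v.
have q1 : q @ within A (nbhs (tau s)) --> (1 : R).
  have : (fun y => dot (diff_quot g (tau s) y) v) @ within A (tau s)^' --> dot v v.
    by apply: cvg_dot => //; exact: cvg_cst.
  rewrite v1 => dq; apply/cvgrPdist_lt => e e0.
  move/cvgrPdist_lt : dq => /(_ e e0); rewrite !near_withinE.
  apply: filterS => y /= H Ay; rewrite /q.
  by case: eqVneq => [_|yt]; [rewrite subrr normr0|exact: H].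
have qtau1 : (q \o tau) @ within B s^' --> (1 : R).
  apply: cvg_comp q1 => W /= WA.
  have := ctau _ WA; rewrite /nbhs /= => H.
  have [e e0 eH] := H; exists e => // x sx xs Bx.
  by apply: (eH x sx Bx); case: (lift x Bx).
have num : (fun x => dot (diff_quot c s x) v) @ within B s^' --> dot w v.
  by apply: cvg_dot => //; exact: cvg_cst.
have : (fun x => dot (diff_quot c s x) v * ((q \o tau) x)^-1) @ within B s^' -->
       dot w v * 1^-1.
  by apply: cvgM => //; apply: cvgV => //; exact: oner_neq0.
rewrite invr1 mulr1; apply: cvg_trans; apply: near_eq_cvg.
have qn0 : \forall x \near within B s^', q (tau x) != 0.
  move/cvgrPdist_lt : qtau1 => /(_ 1 ltr01); apply: filterS => x /= H.
  by apply: contraTN H => /eqP ->; rewrite subr0 normr1 ltxx.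
move: qn0; rewrite !near_withinE; apply: filterS => x H xs Bx.
have := H xs Bx; rewrite /q /=; case: (eqVneq (tau x)) => [tx _|tx qn0] /=.
  rewrite invr1 mulr1 /diff_quot -(lift x Bx).2 -(lift s Bs).2 tx !subrr.
  by rewrite !scaler0 -(scale0r v) dotZl mul0r.
rewrite /diff_quot -(lift x Bx).2 -(lift s Bs).2.
move: qn0; rewrite /diff_quot !dotZl => qn0.
have {}qn0 : dot (g (tau x) - g (tau s)) v != 0.
  by apply: contraNN qn0 => /eqP ->; rewrite mulr0.
rewrite /= /GRing.scale /= [in LHS]invfM invrK; field.
by rewrite qn0 subr_eq0 xs.
Qed.

(** At interior points the relative derivative is the ordinary one, to which
    the fundamental theorem of calculus applies. *)
Lemma has_deriv_in_interior (R : realType) (V : normedModType R) (A : set R)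
    (g : R -> V) (s : R) (l : V) :
  nbhs s A -> has_deriv_in A g s l -> derivable g s 1 /\ derive1 g s = l.
Proof.
move=> nA gl.
have sl : (fun h => diff_quot g s (h + s)) @ 0^' --> l.
  apply: (cvg_comp _ _ _ gl) => W /= [e e0 eW].
  case: nA => /= d d0 dA.
  exists (Num.min e d); first by rewrite /= lt_min e0.
  move=> h; rewrite /= sub0r normrN lt_min => /andP[he hd] h0.
  have sh : `|s - (h + s)| = `|h| by rewrite opprD addrCA subrr addr0 normrN.
  apply: eW => /=; first by rewrite sh.
    by rewrite -subr_eq0 addrK.
  by apply: dA; rewrite /= sh.
have gD : derivable g s 1.
  apply/cvg_ex; exists l; apply: cvg_trans sl; apply: near_eq_cvg.
  near=> h; by rewrite /diff_quot addrK /GRing.scale /= mulr1.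
split=> //; rewrite /derive1; apply: cvg_lim; first exact: norm_hausdorff.
apply: cvg_trans sl; apply: near_eq_cvg.
by near=> h; rewrite /diff_quot addrK.
Unshelve. all: by end_near. Qed.

(** * Geodesic distance on the curve *)

Lemma itv_within_dnbhs_proper (R : realType) (u v t : R) :
  u < v -> u <= t <= v -> ProperFilter (within `[u, v] t^').
Proof.
move=> uv /andP[ut tv].
have [tu|ut'] := leP t u.
  apply: (@segment_within_dnbhs_proper _ _ _ (v - t)).
    by rewrite subr_eq0 gt_eqF// (le_lt_trans tu).
  by move=> x /andP[x0 x1] /=; rewrite in_itv /=; nra.
apply: (@segment_within_dnbhs_proper _ _ _ (u - t)).
  by rewrite subr_eq0 lt_eqF.
by move=> x /andP[x0 x1] /=; rewrite in_itv /=; nra.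
Qed.

Lemma arclength_curveP (R : realType) (p : nat) (gamma : R -> 'rV[R]_p)
    (a : R) : arclength_curve gamma a ->
  [/\ 0 < a,
      forall t : R, 0 <= t <= a -> exists2 v, has_deriv_in `[0, a] gamma t v &
        v = deriv_in `[0, a] gamma t /\ enorm v = 1,
      {within `[0, a], continuous gamma},
      {within `[0, a], continuous (deriv_in `[0, a] gamma)}
    & forall t u : R, 0 <= t <= a -> 0 <= u <= a -> gamma t = gamma u -> t = u].
Proof.
case=> a0 /(_ 1%N)[gD gC] g1 ginj; split=> //.
- move=> t ta; exists (deriv_in `[0, a] gamma t) => //.
    exact: (gD 0%N).
  by split=> //; apply: g1; rewrite ?in_itv.
- apply/subspace_continuousP => t ta; apply: has_deriv_in_continuous.
  exact: (gD 0%N).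
Qed.

Lemma nbhs_itvcc (R : realType) (u v s : R) :
  u < s -> s < v -> nbhs s [set` `[u, v]].
Proof.
move=> us sv; have : s \in `]u, v[ by rewrite in_itv /= us.
move=> /near_in_itvoo; apply: filterS => y.
by rewrite /= !in_itv /= => /andP[/ltW -> /ltW ->].
Qed.

(** No path in the curve is shorter than the arc: its lift tau to the parameter
    interval satisfies |tau'| = |<c', gamma'(tau)>| <= |c'|. *)
Lemma arclength_le_path_length (R : realType) (p : nat)
    (gamma : R -> 'rV[R]_p) (a : R) (c : R -> 'rV[R]_p) (t b : R) :
  arclength_curve gamma a -> C_in `[0, 1] 1 c ->
  c @` `[0, 1] `<=` curve gamma a ->
  0 <= t <= a -> 0 <= b <= a -> c 0 = gamma t -> c 1 = gamma b ->
  `|b - t| <= path_length c.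
Proof.
move=> /arclength_curveP[a0 gD gC gdC ginj] [cD cC] cg ta ba c0 c1.
have {}cD (s : R) : 0 <= s <= 1 -> has_deriv_in `[0, 1] c s (deriv_in `[0, 1] c s).
  by move=> s01; apply: (cD 0%N) => //=; rewrite in_itv.
rewrite /= in cC.
pose tau (s : R) : R := xget 0 [set u | 0 <= u <= a /\ gamma u = c s].
have tauP (s : R) : 0 <= s <= 1 -> 0 <= tau s <= a /\ gamma (tau s) = c s.
  move=> s01; apply: (@xgetPex _ 0 [set u | 0 <= u <= a /\ gamma u = c s]).
  have [|u ua <-] := cg (c s); first by exists s => //=; rewrite in_itv.
  by exists u; split => //; move: ua; rewrite /= in_itv.
have tau0 : tau 0 = t.
  have [? ?] : 0 <= tau 0 <= a /\ gamma (tau 0) = c 0.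
    by apply: tauP; rewrite lexx ler01.
  by apply: ginj => //; rewrite -c0.
have tau1 : tau 1 = b.
  have [? ?] : 0 <= tau 1 <= a /\ gamma (tau 1) = c 1.
    by apply: tauP; rewrite lexx ler01.
  by apply: ginj => //; rewrite -c1.
have tauC (s : R) : 0 <= s <= 1 -> tau @ within `[0, 1] (nbhs s) --> tau s.
  move=> s01; have [taua gtau] := tauP s s01.
  apply: (@cvg_injective_lift _ _ _ `[0, a] gamma tau c) => //.
  - exact: segment_compact.
  - by move=> x y xa ya; apply: ginj; move: xa ya; rewrite !inE /= !in_itv.
  - rewrite near_withinE; near=> x => /=; rewrite !in_itv /=; exact: tauP.
  - by rewrite gtau; apply: has_deriv_in_continuous; exact: cD.
pose dtau (s : R) : R := dot (deriv_in `[0, 1] c s) (deriv_in `[0, a] gamma (tau s)).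
have tauD (s : R) : 0 <= s <= 1 -> has_deriv_in `[0, 1] tau s (dtau s).
  move=> s01; have [taua gtau] := tauP s s01.
  have [v gv [vE v1]] := gD _ taua; rewrite /dtau -vE.
  apply: (@has_deriv_in_lift _ _ `[0, a] _ gamma c) => //.
  - exact: tauC.
  - exact: cD.
have dtauC : {within `[0, 1], continuous dtau}.
  apply/subspace_continuousP => s s01; apply: cvg_dot.
    by move/subspace_continuousP : cC; exact.
  have s01' : 0 <= s <= 1 by move: s01; rewrite /= in_itv.
  move/subspace_continuousP : gdC => /(_ (tau s)).
  have [taua _] := tauP s s01'.
  move=> /(_ _) gdC; apply: (cvg_comp _ _ _ (gdC _)); last by rewrite /= in_itv.
  move=> W /= WA; have := tauC s s01' _ WA; rewrite /nbhs /= => -[e e0 eW].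
  exists e => // x sx; move=> /= xs; apply: (eW x sx xs).
  by move: xs; rewrite !in_itv; case/tauP.
have FTC : (\int[lebesgue_measure]_(x in `[0, 1]) dtau x)%R = b - t.
  rewrite /Rintegral (@continuous_FTC2 R dtau tau) ?ltr01//.
  - by rewrite tau0 tau1.
  - have : {within `[0, 1], continuous tau}.
      apply/subspace_continuousP => s /=; rewrite in_itv; exact: tauC.
    move/continuous_within_itvP => /(_ ltr01)[_ ? ?]; split => //.
    move=> s; rewrite in_itv /= => /andP[s0 s1].
    apply: (proj1 (@has_deriv_in_interior _ _ `[0, 1] tau s (dtau s) _ _)).
      exact: nbhs_itvcc.
    by apply: tauD; rewrite !ltW.
  - move=> s; rewrite in_itv /= => /andP[s0 s1].
    apply: (proj2 (@has_deriv_in_interior _ _ `[0, 1] tau s (dtau s) _ _)).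
      exact: nbhs_itvcc.
    by apply: tauD; rewrite !ltW.
have dtauI : lebesgue_measure.-integrable `[0, 1] (EFin \o dtau).
  apply: continuous_compact_integrable => //; exact: segment_compact.
rewrite -FTC; apply: (le_trans (le_normr_Rintegral _ dtauI)) => //.
apply: le_Rintegral => //.
- apply: continuous_compact_integrable; first exact: segment_compact.
  by move=> s; apply: cvg_norm; exact: dtauC.
- apply: continuous_compact_integrable; first exact: segment_compact.
  apply/subspace_continuousP => s s01.
  rewrite (_ : (fun s => enorm (deriv_in `[0, 1] c s)) = fun s =>
    Num.sqrt (dot (deriv_in `[0, 1] c s) (deriv_in `[0, 1] c s))); last first.
    by apply/funext => x; rewrite enormE.
  apply: (cvg_comp _ Num.sqrt); last exact: sqrt_continuous.
  by apply: cvg_dot; move/subspace_continuousP : cC; exact.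
- move=> s; rewrite /= in_itv /= => s01; apply: normr_dot_le_enorm.
  have [taua _] := tauP s s01.
  by have [v _ [<-]] := gD _ taua.
Unshelve. all: by end_near. Qed.

Lemma affine_segment (R : realType) (a t b s : R) :
  0 <= t <= a -> 0 <= b <= a -> 0 <= s <= 1 -> 0 <= t + (b - t) * s <= a.
Proof. by move=> /andP[t0 ta] /andP[b0 ba] /andP[s0 s1]; apply/andP; nra. Qed.

Lemma inf_min (R : realType) (E : set R) (x : R) :
  E x -> lbound E x -> inf E = x.
Proof.
move=> Ex lbx; apply/eqP; rewrite eq_le; apply/andP; split.
  by apply: ge_inf => //; exists x.
by apply: lb_le_inf => //; exists x.
Qed.

(** The infimum is a minimum, reached by the arc run at constant speed. *)
Lemma geodesic_dist_curve (R : realType) (p : nat) (gamma : R -> 'rV[R]_p)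
    (a t b : R) :
  arclength_curve gamma a -> 0 <= t <= a -> 0 <= b <= a ->
  geodesic_dist (curve gamma a) (gamma t) (gamma b) = `|b - t|.
Proof.
move=> ag ta ba; apply: inf_min; last first.
  move=> _ [c [cC cg c0 c1 ->]].
  exact: (arclength_le_path_length ag cC cg ta ba c0 c1).
have [a0 gD gC gdC ginj] := arclength_curveP ag.
pose L (s : R) : R := t + (b - t) * s.
have La (s : R) : 0 <= s <= 1 -> 0 <= L s <= a by exact: affine_segment.
pose c (s : R) : 'rV[R]_p := gamma (L s).
pose dc (s : R) : 'rV[R]_p := (b - t) *: deriv_in `[0, a] gamma (L s).
have cD (s : R) : 0 <= s <= 1 -> has_deriv_in `[0, 1] c s (dc s).
  move=> s01; apply: (@has_deriv_in_affine _ _ `[0, a]); first exact: La.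
  by have [v gv [<- _]] := gD _ (La s s01).
have dcE (s : R) : 0 <= s <= 1 -> deriv_in `[0, 1] c s = dc s.
  move=> s01; apply: deriv_inE; last exact: cD.
  by apply: itv_within_dnbhs_proper.
exists c; split.
- split=> [[|//] s _ s01|].
    by apply/cvg_ex; exists (dc s); apply: cD.
  suff : {within `[0, 1], continuous dc}.
    by apply: subspace_eq_continuous => s; rewrite inE /= => s01; exact/esym/dcE.
  apply/subspace_continuousP => s s01; apply: cvgZr.
  move/subspace_continuousP : gdC => /(_ (L s) (La s s01)) gdC.
  apply: cvg_comp gdC => W /= [e e0 eW].
  have k0 : 0 < `|b - t| + 1 by rewrite ltr_pwDr.
  exists (e / (`|b - t| + 1)); first by rewrite /= divr_gt0.
  move=> x /= sx xs; apply: eW => /=; last exact: La.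
  rewrite /L (_ : _ - _ = (b - t) * (s - x)); last by ring.
  rewrite normrM; move: sx; rewrite ltr_pdivlMr//; apply: le_lt_trans.
  by rewrite mulrC ler_wpM2l// lerDl.
- by move=> _ [s s01 <-]; exists (L s) => //; exact: La.
- by rewrite /c /L mulr0 addr0.
- by rewrite /c /L mulr1 addrC subrK.
- rewrite /path_length (@eq_Rintegral _ _ _ _ _ (fun=> `|b - t|)).
    by rewrite Rintegral_cst//= lebesgue_measure_itv/= lte_fin ltr01/= oppr0 addr0 mulr1.
  move=> s; rewrite inE /= => s01; rewrite dcE// enormZ.
  by have [v _ [<- ->]] := gD _ (La s s01); rewrite mulr1.
Qed.

Lemma boundary_dist_curve (R : realType) (p : nat) (gamma : R -> 'rV[R]_p)
    (a t : R) : arclength_curve gamma a -> 0 <= t <= a ->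
  boundary_dist gamma a (gamma t) = Num.min t (a - t).
Proof.
move=> ag /[dup] ta /andP[t0 ta'].
have a0 : 0 <= a by exact: le_trans ta'.
have d0 : geodesic_dist (curve gamma a) (gamma t) (gamma 0) = t.
  by rewrite geodesic_dist_curve ?lexx// sub0r normrN ger0_norm.
have da : geodesic_dist (curve gamma a) (gamma t) (gamma a) = a - t.
  by rewrite geodesic_dist_curve ?lexx ?a0// ger0_norm ?subr_ge0.
apply: inf_min.
  have [tat|tat] := leP t (a - t); first by exists (gamma 0); [left|exact: d0].
  by exists (gamma a); [right|exact: da].
by move=> _ [y [->|->] <-]; rewrite ?d0 ?da ge_min lexx ?orbT.
Qed.

(** * The coefficients in dimension one *)

Lemma Rintegral_sqr (R : realType) (u : R) : 0 <= u ->
  \int[lebesgue_measure]_(x in `[0, u]) (x ^+ 2) = u ^+ 3 / 3.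
Proof.
rewrite le_eqVlt => /predU1P[<-|u0].
  by rewrite set_itv1 Rintegral_set1 expr0n /= mul0r.
pose F := fun x : R => 3^-1 * x ^+ 3 : R.
have FD (x : R) : is_derive x (1 : R) F (x ^+ 2).
  have XD : is_derive x (1 : R) (fun y : R => y ^+ 3) (3%:R *: x ^+ 2 *: (1 : R)).
    by apply: DeriveDef; [exact: exprn_derivable|exact: exp_derive].
  have -> : x ^+ 2 = 3^-1 *: (3%:R *: x ^+ 2 *: (1 : R)).
    by rewrite /GRing.scale /= mulr1; field.
  exact: is_deriveZ.
rewrite /Rintegral (@continuous_FTC2 R (fun x => x ^+ 2) F)//.
- by rewrite /= /F; field.
- by apply: continuous_subspaceT => x; exact: exprn_continuous.
- have FC : continuous F.
    by move=> x; apply: differentiable_continuous; apply/derivable1_diffP.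
  split; first by move=> x _; exact: ex_derive.
  - by apply: cvg_at_right_filter; exact: FC.
  - by apply: cvg_at_left_filter; exact: FC.
- by move=> x _; rewrite derive1E; exact: derive_val.
Qed.

(** Nonnegativity of 1 - u^2 turns the real powers of exponent 1 that appear in
    the coefficients into the base itself, also at u = 1. *)
Lemma ratio_bounds (R : realType) (eps t : R) : 0 < eps -> 0 <= t -> t <= eps ->
  0 <= t / eps /\ 0 <= 1 - (t / eps) ^+ 2.
Proof.
move=> eps0 t0 te; have u0 : 0 <= t / eps by rewrite divr_ge0// ltW.
have u1 : t / eps <= 1 by rewrite ler_pdivrMr// mul1r.
by split=> //; rewrite subr_ge0 expr_le1.
Qed.

Lemma sigma0_dim1 (R : realType) (eps t : R) :
  0 < eps -> 0 <= t -> t <= eps ->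
  sigma0 1 eps t = 1 + (t / eps).
Proof.
move=> eps0 t0 te; have [u0 u1] := ratio_bounds eps0 t0 te.
rewrite /sigma0 te /= subrr mul0r (@eq_Rintegral _ _ _ _ _ (fun=> 1)); last first.
  by move=> x _; rewrite powRr0.
rewrite Rintegral_cst//= lebesgue_measure_itv/= lte_fin.
have [_|u_le0] := ltP 0 (t / eps); first by rewrite /= oppr0; field; rewrite gt_eqF.
have -> : (t / eps) = 0 by apply/le_anti; rewrite u_le0.
by rewrite /=; field.
Qed.

Lemma sigma1d_dim1 (R : realType) (eps t : R) :
  0 < eps -> 0 <= t -> t <= eps ->
  sigma1d 1 eps t = - (1 - (t / eps) ^+ 2) / 2.
Proof.
move=> eps0 t0 te; have [u0 u1] := ratio_bounds eps0 t0 te.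
rewrite /sigma1d te /= (_ : (1%:R + 1) / 2 = 1 :> R); last by field.
by rewrite powRr1//; field; rewrite gt_eqF.
Qed.

Lemma sigma2d_dim1 (R : realType) (eps t : R) :
  0 < eps -> 0 <= t -> t <= eps ->
  sigma2d 1 eps t = (1 + (t / eps) ^+ 3) / 3.
Proof.
move=> eps0 t0 te; have [u0 u1] := ratio_bounds eps0 t0 te.
rewrite /sigma2d te /= subrr mul0r.
under eq_Rintegral do rewrite powRr0 mul1r.
by rewrite Rintegral_sqr//; field; rewrite gt_eqF.
Qed.

Lemma sigma3d_dim1 (R : realType) (eps t : R) :
  0 < eps -> 0 <= t -> t <= eps ->
  sigma3d 1 eps t = - (1 - (t / eps) ^+ 4) / 4.
Proof.
move=> eps0 t0 te; have [u0 u1] := ratio_bounds eps0 t0 te.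
rewrite /sigma3d te /= (_ : (1%:R + 1) / 2 = 1 :> R); last by field.
by rewrite powRr1//; field; rewrite gt_eqF.
Qed.

(** (1 + u) factors out of 1 + u^3 and of 1 - u^2, which leaves
    (1 - u + u^2) / 3 - (1 - u)^2 / 4 = (1 + u)^2 / 12. *)
Lemma phi_den_dim1 (R : realType) (eps t : R) :
  0 < eps -> 0 <= t -> t <= eps ->
  phi_den 1 eps t = (1 + (t / eps)) ^+ 4 / 12.
Proof.
move=> eps0 t0 te; rewrite /phi_den sigma0_dim1// sigma1d_dim1// sigma2d_dim1//.
by field; rewrite gt_eqF.
Qed.

Lemma phi2_dim1 (R : realType) (eps t : R) :
  0 < eps -> 0 <= t -> t <= eps ->
  phi2 1 eps t = - (1 / 12) * (1 - 4 * (t / eps) + (t / eps) ^+ 2).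
Proof.
move=> eps0 t0 te; have [u0 u1] := ratio_bounds eps0 t0 te.
rewrite /phi2 phi_den_dim1// sigma1d_dim1// sigma2d_dim1// sigma3d_dim1//.
have : 1 + (t / eps) != 0 by rewrite gt_eqF// ltr_pwDl.
by move: (t / eps) => v v0; field.
Qed.

Lemma drift_dim1 (R : realType) (eps t Px : R) :
  0 < eps -> 0 <= t -> t <= eps -> Px != 0 ->
  drift 1 eps Px t = - (6 * eps ^+ 2 * (eps - t) / (Px * (eps + t) ^+ 3)).
Proof.
move=> eps0 t0 te Px0; rewrite /drift phi_den_dim1// sigma1d_dim1//; field.
by rewrite Px0 !gt_eqF//= ltr_pwDl.
Qed.
(** The two branches of the coefficients agree at t = eps, so that the interior
    formulas hold from there on. *)
Lemma phi2_interior (R : realType) (eps t : R) :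
  0 < eps -> eps <= t -> phi2 1 eps t = 1 / 6.
Proof.
move=> eps0; rewrite le_eqVlt => /predU1P[<-|et].
  by rewrite phi2_dim1 ?lexx ?(ltW eps0)// divff ?gt_eqF//; field.
rewrite /phi2 /phi_den /sigma0 /sigma1d /sigma2d /sigma3d !leNgt et /=.
by field.
Qed.

Lemma drift_interior (R : realType) (eps t Px : R) :
  0 < eps -> eps <= t -> drift 1 eps Px t = 0.
Proof.
move=> eps0; rewrite le_eqVlt => /predU1P[<-|et].
  rewrite /drift sigma1d_dim1 ?lexx ?(ltW eps0)//.
  by rewrite divff ?gt_eqF// expr1n subrr oppr0 !mul0r.
by rewrite /drift /sigma1d leNgt et /= mul0r.
Qed.

(** * Derivatives along the frame *)

Lemma has_deriv_inZ (R : realType) (V : normedModType R) (A : set R)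
    (g : R -> V) (k t : R) (l : V) :
  has_deriv_in A g t l -> has_deriv_in A (fun x => k *: g x) t (k *: l).
Proof.
move=> gl; have : (fun x => k *: diff_quot g t x) @ within A t^' --> k *: l.
  exact: cvgZr.
apply: cvg_trans; apply: near_eq_cvg; near=> x.
by rewrite /diff_quot -scalerBr !scalerA mulrC.
Unshelve. all: by end_near. Qed.

Lemma D_curveE (R : realType) (p : nat) (gamma : R -> 'rV[R]_p) (a : R)
    (P : 'rV[R]_p -> R) (eps : R) (o : R -> R) (f : 'rV[R]_p -> R) (t : R) :
  let d := boundary_dist gamma a (gamma t) in
  D_curve gamma a P eps o f t =
    phi2 1 eps d * frame_deriv gamma a o 2 f t
    + drift 1 eps (P (gamma t)) d * frame_deriv gamma a o 1 f t.
Proof. by rewrite /D_curve /D_op big_ord0 mulr0 add0r. Qed.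

(** A point of the normal domain has a segment of the domain on at least one
    side: towards the parameter a, or towards 0 when it sits at a. *)
Lemma normal_dom_proper (R : realType) (a t o s : R) :
  0 < a -> o = 1 \/ o = -1 -> normal_dom a t o s ->
  ProperFilter (within (normal_dom a t o) s^').
Proof.
move=> a0 o1; rewrite /normal_dom /= => y01.
have oo : o * o = 1 by case: o1 => ->; rewrite ?mulrNN mulr1.
have o0 : o != 0 by case: o1 => ->; rewrite ?oppr_eq0 oner_neq0.
have key (b : R) : b != t + o * s -> 0 <= b <= a ->
    ProperFilter (within (normal_dom a t o) s^').
  move=> bs ba; apply: (@segment_within_dnbhs_proper _ _ _ (o * (b - (t + o * s)))).
    by rewrite mulf_neq0// subr_eq0.
  move=> x x01; rewrite /normal_dom /=.
  have -> : t + o * (s + x * (o * (b - (t + o * s)))) =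
      t + o * s + (b - (t + o * s)) * x
      + (o * o - 1) * (x * (b - (t + o * s))).
    by ring.
  by rewrite oo subrr mul0r addr0; exact: affine_segment.
have [ys|ys] := eqVneq (t + o * s) a.
  by apply: (key 0); rewrite ?ys ?lexx ?ltW// lt_eqF.
by apply: (key a); rewrite ?lexx ?ltW// eq_sym.
Qed.

(** The sign o appears once per derivative, and o^2 = 1. *)
Lemma frame_derivE (R : realType) (p : nat) (gamma : R -> 'rV[R]_p) (a : R)
    (f : 'rV[R]_p -> R) (o : R -> R) (t : R) :
  0 < a -> 0 <= t <= a -> o t = 1 \/ o t = -1 -> C2_on_curve gamma a f ->
  frame_deriv gamma a o 1 f t = o t * deriv_in_n `[0, a] 1 (f \o gamma : R -> R) t
  /\ frame_deriv gamma a o 2 f t = deriv_in_n `[0, a] 2 (f \o gamma : R -> R) t.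
Proof.
move=> a0 ta; rewrite /frame_deriv; move: (o t) => {}o o1 [fD _].
have oo : o * o = 1 by case: o1 => ->; rewrite ?mulrNN mulr1.
pose g : R -> R := f \o gamma.
pose B := normal_dom a t o.
have B0 : B 0 by rewrite /B /normal_dom /= mulr0 addr0.
have D1 (s : R) : B s ->
    deriv_in B (fun s => g (t + o * s)) s = o * deriv_in `[0, a] g (t + o * s).
  move=> Bs; apply: deriv_inE; first exact: normal_dom_proper.
  apply: (@has_deriv_in_affine _ _ `[0, a]) => //.
  by apply: (fD 0%N).
have tE : t + o * 0 = t by rewrite mulr0 addr0.
split; first by rewrite /= D1// tE.
rewrite /=; apply: deriv_inE; first exact: normal_dom_proper.
apply: (@eq_has_deriv_in _ _ _ (fun s => o *: deriv_in `[0, a] g (t + o * s))) => //.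
  by move=> s Bs; rewrite D1.
have -> : deriv_in `[0, a] (deriv_in `[0, a] g) t =
    o *: (o *: deriv_in `[0, a] (deriv_in `[0, a] g) t).
  by rewrite scalerA oo /GRing.scale /= mul1r.
apply: (@has_deriv_in_affine _ _ `[0, a] _ (fun y => o *: deriv_in `[0, a] g y)) => //.
by rewrite tE; apply: has_deriv_inZ; apply: (fD 1%N).
Qed.

(** * The sign of the frame near the ends *)

(** With o = 1 the geodesic from gamma t would stay in the curve for the time
    a - t, longer than the boundary distance t. *)
Lemma boundary_frame_left (R : realType) (p : nat) (gamma : R -> 'rV[R]_p)
    (a eps : R) (o : R -> R) (t : R) :
  arclength_curve gamma a -> boundary_frame gamma a eps o ->
  0 <= t -> t < a - t -> t < eps -> o t = -1.
Proof.
move=> ag fr t0 tat te.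
have ta : 0 <= t <= a by apply/andP; lra.
have dE : boundary_dist gamma a (gamma t) = t.
  by rewrite boundary_dist_curve// min_l// ltW.
have tI : t \in `[0, a] by rewrite in_itv.
have [[sgn| //] fr'] := fr t tI; rewrite dE in fr'.
suff : a - t <= t by rewrite leNgt tat.
apply/(fr' te); first by lra.
by rewrite /normal_dom /= sgn; apply/andP; lra.
Qed.

Lemma boundary_frame_right (R : realType) (p : nat) (gamma : R -> 'rV[R]_p)
    (a eps : R) (o : R -> R) (t : R) :
  arclength_curve gamma a -> boundary_frame gamma a eps o ->
  t <= a -> a - t < t -> a - t < eps -> o t = 1.
Proof.
move=> ag fr t0 tat te.
have ta : 0 <= t <= a by apply/andP; lra.
have dE : boundary_dist gamma a (gamma t) = a - t.
  by rewrite boundary_dist_curve// min_r// ltW.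
have tI : t \in `[0, a] by rewrite in_itv.
have [[ //|sgn] fr'] := fr t tI; rewrite dE in fr'.
suff : t <= a - t by rewrite leNgt tat.
apply/(fr' te); first by lra.
by rewrite /normal_dom /= sgn; apply/andP; lra.
Qed.

(** * The operator on the curve *)

Theorem corollary5p1 (R : realType) (p : nat) (gamma : R -> 'rV[R]_p) (a : R)
    (P : 'rV[R]_p -> R) :
  arclength_curve gamma a ->
  density_on_curve gamma a P ->
  exists eps0 : R, 0 < eps0 /\
  forall eps : R, 0 < eps -> eps < eps0 ->
  forall o : R -> R, boundary_frame gamma a eps o ->
  forall f : 'rV[R]_p -> R, C2_on_curve gamma a f ->
  let f1 : R -> R := deriv_in_n `[0, a] 1 (f \o gamma : R -> R) in
  let f2 : R -> R := deriv_in_n `[0, a] 2 (f \o gamma : R -> R) in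
  let Df : R -> R := D_curve gamma a P eps o f in
  [/\ forall t, 0 <= t <= eps ->
        Df t = - (1 / 12) * (1 - 4 * (t / eps) + (t / eps) ^+ 2) * f2 t
               + 6 * eps ^+ 2 * (eps - t)
                 / (P (gamma t) * (eps + t) ^+ 3) * f1 t,
      forall t, eps <= t <= a - eps -> Df t = 1 / 6 * f2 t,
      forall t, a - eps <= t <= a ->
        Df t = - (1 / 12)
                 * (1 - 4 * ((a - t) / eps) + ((a - t) / eps) ^+ 2) * f2 t
               - 6 * eps ^+ 2 * (eps + t - a)
                 / (P (gamma t) * (eps + a - t) ^+ 3) * f1 t,
      (let t := (2 - Num.sqrt 3) * eps in
       Df t = (1 + 2 / Num.sqrt 3) / P (gamma t) * f1 t)
    & (let t := a - (2 - Num.sqrt 3) * eps in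
       Df t = - ((1 + 2 / Num.sqrt 3) / P (gamma t)) * f1 t)].
Proof.
move=> ag [_ [m [N [m0 Pm]]] _].
have a0 : 0 < a by case: ag.
have P0 (t : R) : 0 <= t <= a -> P (gamma t) != 0.
  move=> ta; have [|mP _] := Pm (gamma t); first by exists t.
  by rewrite gt_eqF// (lt_le_trans m0).
exists (a / 2); split; first by rewrite divr_gt0.
move=> eps eps0 epsa o fr f fC f1 f2 Df.
have epsa' : eps < a - eps by lra.
have frameE (t : R) : 0 <= t <= a ->
    [/\ frame_deriv gamma a o 1 f t = o t * f1 t & frame_deriv gamma a o 2 f t = f2 t].
  move=> ta; have tI : t \in `[0, a] by rewrite in_itv.
  have [sgn _] := fr t tI.
  by have [? ?] := frame_derivE a0 ta sgn fC; split.
have left_end (t : R) : 0 <= t <= eps ->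
    Df t = - (1 / 12) * (1 - 4 * (t / eps) + (t / eps) ^+ 2) * f2 t
           + 6 * eps ^+ 2 * (eps - t) / (P (gamma t) * (eps + t) ^+ 3) * f1 t.
  move=> /andP[t0 te]; have ta : 0 <= t <= a by apply/andP; lra.
  rewrite /Df D_curveE boundary_dist_curve// min_l; last by lra.
  have [-> ->] := frameE t ta.
  rewrite phi2_dim1// drift_dim1 ?P0//.
  (* At t = eps the frame may have either sign, but the drift is 0. *)
  move: te; rewrite le_eqVlt => /predU1P[->|te].
    by rewrite subrr !(mulr0, mul0r, oppr0).
  by rewrite (boundary_frame_left ag fr t0 _ te) ?mulN1r ?mulrNN//; lra.
have right_end (t : R) : a - eps <= t <= a ->
    Df t = - (1 / 12) * (1 - 4 * ((a - t) / eps) + ((a - t) / eps) ^+ 2) * f2 t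
           - 6 * eps ^+ 2 * (eps + t - a)
             / (P (gamma t) * (eps + a - t) ^+ 3) * f1 t.
  move=> /andP[t0 te]; have ta : 0 <= t <= a by apply/andP; lra.
  rewrite /Df D_curveE boundary_dist_curve// min_r; last by lra.
  have [-> ->] := frameE t ta.
  rewrite phi2_dim1 ?drift_dim1 ?P0 ?subr_ge0//; try lra.
  rewrite opprB !addrA -[- (6 * _ * _ / _ * _)]mulNr; congr (_ + _).
  move: t0; rewrite le_eqVlt => /predU1P[te'|t0].
    have -> : eps + t - a = 0 by rewrite -te'; ring.
    by rewrite !(mulr0, mul0r, oppr0).
  by rewrite (boundary_frame_right ag fr te) ?mul1r//; lra.
have sqrt3 : Num.sqrt 3 ^+ 2 = 3 :> R by rewrite sqr_sqrtr.
have sqrt3_gt1 : 1 < Num.sqrt 3 :> R by rewrite -[X in X < _]sqrtr1 ltr_sqrt// ltr1n.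
have sqrt3_lt2 : Num.sqrt 3 < 2 :> R by nra.
have root3 : 1 - 4 * (2 - Num.sqrt 3) + (2 - Num.sqrt 3) ^+ 2 = 0 :> R by nra.
have u0 : 0 < 2 - Num.sqrt 3 :> R by lra.
have u1 : 2 - Num.sqrt 3 < 1 :> R by lra.
have coefE (Px : R) : Px != 0 -> let t := (2 - Num.sqrt 3) * eps in
    6 * eps ^+ 2 * (eps - t) / (Px * (eps + t) ^+ 3) = (1 + 2 / Num.sqrt 3) / Px.
  move=> Px0 t; have eps_n0 : eps != 0 by rewrite gt_eqF.
  have r0 : Num.sqrt 3 != 0 :> R by rewrite gt_eqF//; lra.
  have r3 : 3 - Num.sqrt 3 != 0 :> R by rewrite gt_eqF//; lra.
  rewrite {}/t; move: (Num.sqrt 3) sqrt3 r0 r3 => r rr r0 r3.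
  have key : 6 * (r - 1) / (3 - r) ^+ 3 = (r + 2) / r.
    apply/eqP; rewrite eqr_div ?expf_neq0// -subr_eq0; apply/eqP.
    (* The difference of the cross products is a multiple of r^2 - 3. *)
    transitivity ((r ^+ 2 - 3) * (r ^+ 2 - 7 * r + 18)); first by ring.
    by rewrite rr subrr mul0r.
  transitivity (6 * (r - 1) / (3 - r) ^+ 3 / Px).
    rewrite (_ : eps + (2 - r) * eps = (3 - r) * eps); last by ring.
    by field; rewrite Px0 eps_n0 r3.
  by rewrite key; field; rewrite Px0 r0.
have uE : (2 - Num.sqrt 3) * eps / eps = 2 - Num.sqrt 3 by rewrite mulfK// gt_eqF.
split=> //.
- move=> t /andP[te tae]; have ta : 0 <= t <= a by apply/andP; lra.
  rewrite /Df D_curveE boundary_dist_curve//.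
  have ed : eps <= Num.min t (a - t) by rewrite le_min te; lra.
  have [_ ->] := frameE t ta.
  by rewrite phi2_interior// drift_interior// mul0r addr0.
- move=> t; rewrite left_end; last by apply/andP; rewrite /t; nra.
  rewrite /t uE root3 mulr0 mul0r add0r coefE// P0//.
  by apply/andP; nra.
- move=> t; have tE : a - t = (2 - Num.sqrt 3) * eps by rewrite /t; ring.
  rewrite right_end; last by apply/andP; rewrite /t; nra.
  rewrite tE uE root3 mulr0 mul0r sub0r -mulNr; congr (- _ * _).
  have -> : eps + t - a = eps - (2 - Num.sqrt 3) * eps by rewrite -tE; ring.
  have -> : eps + a - t = eps + (2 - Num.sqrt 3) * eps by rewrite -tE; ring.
  by rewrite coefE// P0//; apply/andP; rewrite /t; nra.
Qed.
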